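(* Assume (A1) and (A2). Let $u(t,x)=\max_{q\in\mathbb R^n}\{\langle x,q\rangle-\sigma^*(q)-\int_0^tH(\tau,q)\,d\tau\}$ be the viscosity solution, defined by the Hopf-type formula, of the problem $u_t+H(t,D_xu)=0$ in $\Omega$, $u(0,x)=\sigma(x)$ on $\mathbb R^n$. Suppose that there exists $t_*\in(0,T)$ such that the mapping $y\mapsto x(t_*,y)=y+\int_0^{t_*}H_p(\tau,\sigma_y(y))\,d\tau$ from $\mathbb R^n$ to $\mathbb R^n$ is injective. Then $u(t,x)$ is continuously differentiable in the open strip $(0,t_* )\times\mathbb R^n$.
   Context: Let $T>0$ and $\Omega=(0,T)\times\mathbb R^n$. Let $H=H(t,p)$ be a real-valued function of class $C^1$ on $[0,T]\times\mathbb R^n$ and $\sigma:\mathbb R^n\to\mathbb R$ be convex and of class $C^1$. $\sigma^*:\mathbb R^n\to\mathbb R\cup\{+\infty\}$ is the Fenchel conjugate of $\sigma$; $H_p$ is the gradient of $H$ in $p$ and $\sigma_y$ the gradient of $\sigma$. Condition (A1): for every $(t_0,x_0)\in[0,T)\times\mathbb R^n$ there exist positive constants $r$ and $N$ such that $$\langle x,p\rangle-\sigma^*(p)-\int_0^tH(\tau,p)\,d\tau<\max_{|q|\le N}\Big\{\langle x,q\rangle-\sigma^*(q)-\int_0^tH(\tau,q)\,d\tau\Big\}$$ whenever $(t,x)\in[0,T)\times\mathbb R^n$, $|t-t_0|+|x-x_0|<r$ and $|p|>N$. Condition (A2): $H$ has one of the two following forms: a) $H(t,\cdot)$ is convex for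 all $t\in(0,T)$, or $H(t,\cdot)$ is concave for all $t\in(0,T)$; b) $H(t,p)=g(t)h(p)+k(t)$ for some functions $g,h,k$, where $g(t)$ does not change its sign on $(0,T)$. It is known that under (A1) and (A2) the function $u$ is a viscosity solution of the stated Cauchy problem. *)

(* Defs.v *)
From HB Require Import structures.
From mathcomp Require Import all_boot all_order all_algebra.
From mathcomp Require Import all_classical all_reals all_analysis.

Set Implicit Arguments.
Unset Strict Implicit.
Unset Printing Implicit Defensive.

Import Order.TTheory GRing.Theory Num.Theory.
Import numFieldNormedType.Exports.

Local Open Scope classical_set_scope.
Local Open Scope ring_scope.

Definition is_max (d : Order.disp_t) (S : porderType d) (A : set S) (m : S) :=
  A m /\ ubound A m.

Definition dotp (R : realType) (n : nat) (x y : 'rV[R]_n) : R :=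
  \sum_(i < n) x 0 i * y 0 i.

(* The library norm on 'rV[R]_n is the sup norm; |x| is the Euclidean one. *)
Definition enorm (R : realType) (n : nat) (x : 'rV[R]_n) : R :=
  Num.sqrt (dotp x x).

Definition grad (R : realType) (n : nat) (f : 'rV[R]_n -> R) (x : 'rV[R]_n) :
    'rV[R]_n :=
  \row_(i < n) 'D_(delta_mx 0 i) f x.

(* Only used with V finite-dimensional and A open: there, continuity of the
   derivative is the same as continuity of all directional derivatives. *)
Definition C1_on (R : realType) (V : normedModType R) (A : set V) (f : V -> R) :=
  forall z, A z ->
    differentiable f z /\ forall v : V, {for z, continuous (fun w => 'D_v f w)}.

(* C^1 on [0,T] x R^n, with one-sided time derivatives at t = 0 and t = T:
   the partial derivatives exist and are jointly continuous on the closed slab.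
   The values of f at times outside [0,T] play no role. *)
Definition C1_slab (R : realType) (n : nat) (T : R) (f : R -> 'rV[R]_n -> R) :=
  let slab := [set z : R * 'rV[R]_n | 0 <= z.1 <= T] in
  [/\ forall t p, 0 <= t <= T -> differentiable (f t) p,
      {within slab, continuous (fun z => grad (f z.1) z.2)}
    & exists2 ft : R -> 'rV[R]_n -> R,
        forall t p, 0 <= t <= T ->
          (f s p - f t p) / (s - t) @[s --> within `[0, T] t^'] --> ft t p
      & {within slab, continuous (fun z => ft z.1 z.2)}].

Definition fenchel (R : realType) (n : nat) (sigma : 'rV[R]_n -> R)
    (p : 'rV[R]_n) : \bar R :=
  ereal_sup (range (fun x => (dotp x p - sigma x)%:E)).

Definition hopf (R : realType) (n : nat) (H : R -> 'rV[R]_n -> R)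
    (sigma : 'rV[R]_n -> R) (t : R) (x q : 'rV[R]_n) : \bar R :=
  ((dotp x q)%:E - fenchel sigma q
    - (\int[lebesgue_measure]_(tau in `[0, t]) H tau q)%R%:E)%E.

Definition condA1 (R : realType) (n : nat) (T : R) (H : R -> 'rV[R]_n -> R)
    (sigma : 'rV[R]_n -> R) :=
  forall (t0 : R) (x0 : 'rV[R]_n), 0 <= t0 < T ->
  exists r N : R, [/\ 0 < r, 0 < N &
    forall (t : R) (x p : 'rV[R]_n),
      0 <= t < T -> `|t - t0| + enorm (x - x0) < r -> N < enorm p ->
      exists2 m : \bar R,
        is_max [set hopf H sigma t x q | q in [set q | enorm q <= N]] m
      & (hopf H sigma t x p < m)%E].

Definition condA2 (R : realType) (n : nat) (T : R) (H : R -> 'rV[R]_n -> R) :=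
  ((forall t, 0 < t < T -> convex_function setT (H t)) \/
   (forall t, 0 < t < T -> convex_function setT (fun p => - H t p))) \/
  (exists (g : R -> R) (h : 'rV[R]_n -> R) (k : R -> R),
     (forall t p, 0 <= t <= T -> H t p = g t * h p + k t) /\
     ((forall t, 0 < t < T -> 0 <= g t) \/ (forall t, 0 < t < T -> g t <= 0))).

Definition charact (R : realType) (n : nat) (H : R -> 'rV[R]_n -> R)
    (sigma : 'rV[R]_n -> R) (t : R) (y : 'rV[R]_n) : 'rV[R]_n :=
  y + \row_(i < n)
    \int[lebesgue_measure]_(tau in `[0, t]) grad (H tau) (grad sigma y) 0 i.

(* Main.v *)
(* A maximizer q of the Hopf formula at (t, x) satisfies the first-order
   condition y := x - \int_0^t H_p(tau, q) dtau \in \partial sigma^*(q), that is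
   q = sigma_y(y) and x = x(t, y): every point of [0, T) x R^n lies on the
   characteristic given by any of its maximizers.  At time tstar characteristics
   do not meet, so sigma_y(y) is the unique maximizer at (tstar, x(tstar, y)).
   Along the characteristic from y, the gap between the Hopf values at
   q = sigma_y(y) and at some p <> q is
     sigma^*(p) - sigma^*(q) - <y, p - q>
       + \int_0^t [H(tau, p) - H(tau, q) - <H_p(tau, q), p - q>] dtau.
   By (A2) the integrand has a constant sign, so the gap is monotone in t; being
   positive at t = 0 and at t = tstar, it is positive in between.  Hence the
   maximizer is unique in the strip, and Danskin's argument applies: by (A1) it
   is locally bounded, so it depends continuously on (t, x), and u has the
   differential (s, v) |-> <v, q> - s H(t, q). *)
Require Import Defs.
From HB Require Import structures.
From mathcomp Require Import all_boot all_order all_algebra.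
From mathcomp Require Import all_classical all_reals all_analysis.
From mathcomp Require Import ring lra.

Set Implicit Arguments.
Unset Strict Implicit.
Unset Printing Implicit Defensive.

Import Order.TTheory GRing.Theory Num.Theory.
Import numFieldNormedType.Exports.

Local Open Scope classical_set_scope.
Local Open Scope ring_scope.

(** * Euclidean pairing, directional derivatives and the gradient inequality *)

Section DotProduct.
Context {R : realType} {n : nat}.
Implicit Types (x y z v : 'rV[R]_n) (a : R).

Lemma dotpC x y : dotp x y = dotp y x.
Proof. by apply: eq_bigr => i _; rewrite mulrC. Qed.

Lemma dotpDl x y z : dotp (x + y) z = dotp x z + dotp y z.
Proof. by rewrite -big_split; apply: eq_bigr => i _; rewrite mxE mulrDl. Qed.

Lemma dotpZl a x y : dotp (a *: x) y = a * dotp x y.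
Proof.
by rewrite [RHS]big_distrr; apply: eq_bigr => i _; rewrite mxE /= mulrA.
Qed.

Lemma dotpNl x y : dotp (- x) y = - dotp x y.
Proof. by rewrite -scaleN1r dotpZl mulN1r. Qed.

Lemma dotpBl x y z : dotp (x - y) z = dotp x z - dotp y z.
Proof. by rewrite dotpDl dotpNl. Qed.

Lemma dotpDr x y z : dotp x (y + z) = dotp x y + dotp x z.
Proof. by rewrite dotpC dotpDl !(dotpC x). Qed.

Lemma dotpZr a x y : dotp x (a *: y) = a * dotp x y.
Proof. by rewrite dotpC dotpZl dotpC. Qed.

Lemma dotpNr x y : dotp x (- y) = - dotp x y.
Proof. by rewrite dotpC dotpNl dotpC. Qed.

Lemma dotpBr x y z : dotp x (y - z) = dotp x y - dotp x z.
Proof. by rewrite dotpDr dotpNr. Qed.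

Lemma dotp_ge0 x : 0 <= dotp x x.
Proof. by apply: sumr_ge0 => i _; rewrite -expr2 sqr_ge0. Qed.

Lemma dotp_eq0 x : dotp x x = 0 -> x = 0.
Proof.
move=> /eqP; rewrite psumr_eq0 => [/allP h|i _]; last by rewrite -expr2 sqr_ge0.
apply/rowP => i; have := h i (mem_index_enum _).
by rewrite /= mulf_eq0 orbb mxE => /eqP.
Qed.

Lemma rV_coord_le x i : `|x 0 i| <= `|x|.
Proof.
rewrite [leRHS]/Num.norm /= mx_normrE.
by apply: (le_bigmax _ (fun ij : 'I_1 * 'I_n => `|x ij.1 ij.2|) (0, i)).
Qed.

(** The factor [n] is the price of the sup norm: each of the [n] products of coordinates is at most
    [|x| |y|]. *)
Lemma dotp_le x y : `|dotp x y| <= n%:R * (`|x| * `|y|).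
Proof.
rewrite (le_trans (ler_norm_sum _ _ _))// -[n in n%:R]card_ord.
rewrite mulr_natl -sumr_const; apply: ler_sum => i _.
by rewrite normrM ler_pM// rV_coord_le.
Qed.

Lemma enorm_ge x : `|x| <= enorm x.
Proof.
rewrite [leLHS]/Num.norm /= mx_normrE; apply/bigmax_leP; split.
  by rewrite /enorm sqrtr_ge0.
move=> [i j] _ /=; rewrite (ord1 i) -sqrtr_sqr ler_wsqrtr//.
rewrite /dotp (bigD1 j)//= expr2 lerDl.
by apply: sumr_ge0 => k _; rewrite -expr2 sqr_ge0.
Qed.

Lemma dotp_cvg (I : Type) (F : set_system I) (f g : I -> 'rV[R]_n) x y :
  Filter F -> f @ F --> x -> g @ F --> y ->
  dotp (f i) (g i) @[i --> F] --> dotp x y.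
Proof.
move=> FF fx gy; rewrite /dotp.
elim: (index_enum _) => [|j r IH].
  by under eq_cvg do rewrite big_nil; rewrite big_nil; exact: cvg_cst.
under eq_cvg do rewrite big_cons; rewrite big_cons.
apply: cvgD IH; apply: cvgM.
  exact: (cvg_comp f (fun M => M 0 j) fx (@coord_continuous R 1 n 0 j x)).
exact: (cvg_comp g (fun M => M 0 j) gy (@coord_continuous R 1 n 0 j y)).
Qed.

Lemma enorm_cvg0 (I : Type) (F : set_system I) (f : I -> 'rV[R]_n) :
  Filter F -> f @ F --> (0 : 'rV[R]_n) -> enorm (f i) @[i --> F] --> (0 : R).
Proof.
move=> FF f0; have := dotp_cvg FF f0 f0.
rewrite (_ : dotp 0 0 = 0) => [h|]; last first.
  by rewrite -(scale0r (0 : 'rV[R]_n)) dotpZl mul0r.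
rewrite -[X in _ --> X](@sqrtr0 R).
exact: (cvg_comp _ _ h (@sqrt_continuous R 0)).
Qed.

Lemma derive_grad (f : 'rV[R]_n -> R) x v :
  differentiable f x -> 'D_v f x = dotp (grad f x) v.
Proof.
move=> df; rewrite deriveE// [in LHS](row_sum_delta v) linear_sum.
by apply: eq_bigr => i _; rewrite linearZ /= mxE deriveE// mulrC.
Qed.

Lemma derivable_line (f : 'rV[R]_n -> R) x v a :
  differentiable f (x + a *: v) ->
  is_derive a 1 (fun s => f (x + s *: v)) (dotp (grad f (x + a *: v)) v).
Proof.
move=> df.
(* The quotient of the restriction to the line is literally that of [f] at [x + a v] in direction
   [v], so no chain rule is invoked. *)
have E : (fun h : R => h^-1 *: (((fun s => f (x + s *: v)) \o shift a) (h *: 1)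
    - f (x + a *: v))) =
    (fun h : R => h^-1 *:
      ((f \o shift (x + a *: v)) (h *: v) - f (x + a *: v))).
  apply/funext => h /=; congr (_ *: (f _ - _)).
  by rewrite scalerDl [h%:A]mulr1 addrCA.
apply: DeriveDef.
  by rewrite /derivable E; exact: diff_derivable.
by rewrite /derive E -derive_grad.
Qed.

Lemma MVT_line (f : 'rV[R]_n -> R) x y :
  (forall z, differentiable f z) ->
  exists2 c : R, 0 <= c <= 1 &
    f y - f x = dotp (grad f (x + c *: (y - x))) (y - x).
Proof.
move=> df.
have dl a : is_derive a 1 (fun s => f (x + s *: (y - x)))
    (dotp (grad f (x + a *: (y - x))) (y - x)) by exact: derivable_line.
have [|c] := @MVT_segment R (fun s => f (x + s *: (y - x)))
  (fun a => dotp (grad f (x + a *: (y - x))) (y - x)) 0 1 ler01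
  (fun a _ => dl a).
  apply: derivable_within_continuous => a _; have := dl a.
  by case.
rewrite in_itv /= scale1r scale0r addr0 (addrC x (y - x)) subrK subr0 mulr1.
move=> c01 ->.
by exists c.
Qed.

Lemma cvg_dnbhs_ge (f : R -> R) l a :
  f h @[h --> 0^'] --> l -> (forall h, 0 < h < 1 -> a <= f h) -> a <= l.
Proof.
move=> /cvg_dnbhs_at_right fl fa; apply: (cvgr_to_ge fl).
near=> h; apply: fa; apply/andP; split; near: h.
  exact: nbhs_right_gt.
exact: nbhs_right_lt.
Unshelve. all: by end_near. Qed.

Lemma derive_ge (f : 'rV[R]_n -> R) x v a : derivable f x v ->
  (forall h, 0 < h < 1 -> f x + h * a <= f (h *: v + x)) -> a <= 'D_v f x.
Proof.
move=> df fa; apply: (cvg_dnbhs_ge df) => h h01.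
have h0 : 0 < h by case/andP: h01.
rewrite /= [_ *: _](mulrC _) ler_pdivlMr// mulrC lerBrDl.
exact: fa.
Qed.

Lemma convex_grad_le (f : 'rV[R]_n -> R) x y :
  convex_function setT f -> differentiable f x ->
  f x + dotp (grad f x) (y - x) <= f y.
Proof.
move=> cf df; rewrite -lerBrDl -derive_grad// -lerN2 opprB.
(* Convexity bounds the quotients of [f] from above, whereas [derive_ge] yields lower bounds; hence
   the passage to [- f]. *)
have -> : - 'D_(y - x) f x = 'D_(y - x) (- f) x.
  by rewrite deriveN//; exact: diff_derivable.
apply: derive_ge; first exact/derivableN/diff_derivable.
move=> h /andP[h0 h1].
have := cf (Itv01 (ltW h0) (ltW h1)) y x (in_setT _) (in_setT _).
rewrite -[X in _ <= X -> _]/(h * f y + (1 - h) * f x).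
rewrite -[X in f X]/(h *: y + (1 - h) *: x) => cfh.
have -> : h *: (y - x) + x = h *: y + (1 - h) *: x.
  by rewrite scalerBr scalerBl scale1r addrAC addrA.
by rewrite -[X in _ <= X]/(- f _) -[X in X + _ <= _]/(- f _); lra.
Qed.

(** Testing the subgradient inequality in the direction [v = q - grad f x] gives
    [<q, v> <= <grad f x, v>], that is [<v, v> <= 0]. *)
Lemma grad_unique (f : 'rV[R]_n -> R) x q : differentiable f x ->
  (forall y, f x + dotp q (y - x) <= f y) -> q = grad f x.
Proof.
move=> df fq; apply/eqP; rewrite -subr_eq0; apply/eqP/dotp_eq0.
have : dotp q (q - grad f x) <= dotp (grad f x) (q - grad f x).
  rewrite -derive_grad//; apply: derive_ge; first exact: diff_derivable.
  by move=> h _; have := fq (h *: (q - grad f x) + x); rewrite addrK dotpZr.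
rewrite -subr_le0 -dotpBl => le0; apply/eqP.
by rewrite eq_le le0 dotp_ge0.
Qed.

End DotProduct.

(** * Integrals of continuous functions over segments *)

Section ContinuousIntegrand.
Context {R : realType}.
Notation mu := (@lebesgue_measure R).
Implicit Types (f : R -> R) (a b s t : R).

Lemma continuous_itv_integrable f a b :
  continuous f -> mu.-integrable `[a, b] (EFin \o f).
Proof.
move=> cf; apply: continuous_compact_integrable; first exact: segment_compact.
exact: continuous_subspaceT.
Qed.

Lemma Rintegral_sum (I : Type) (r : seq I) (f : I -> R -> R) a b :
  (forall i, continuous (f i)) ->
  \int[mu]_(x in `[a, b]) (\sum_(i <- r) f i x) =
  \sum_(i <- r) \int[mu]_(x in `[a, b]) f i x.
Proof.
move=> cf; elim: r => [|i r IH].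
  rewrite big_nil; under eq_Rintegral do rewrite big_nil.
  by rewrite Rintegral_cst// mul0r.
rewrite big_cons -IH; under eq_Rintegral do rewrite big_cons.
rewrite RintegralD//; first exact: continuous_itv_integrable.
apply: continuous_itv_integrable => x.
elim: {IH} r => [|j r IH].
  rewrite (_ : (fun _ => _) = cst 0); first exact: cvg_cst.
  by apply/funext => y; rewrite big_nil.
rewrite (_ : (fun _ => _) = (fun x => f j x + \sum_(i <- r) f i x)).
  by apply: cvgD IH; exact: cf.
by apply/funext => y; rewrite big_cons.
Qed.

Lemma integral_mean_value f s t : continuous f -> 0 < s -> 0 < t ->
  exists2 c, `|c - s| <= `|t - s| &
    \int[mu]_(x in `[0, t]) f x - \int[mu]_(x in `[0, s]) f x = f c * (t - s).
Proof.
move=> cf.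
have mv a b : 0 < a -> a <= b -> exists2 c, c \in `[a, b] &
    \int[mu]_(x in `[0, b]) f x - \int[mu]_(x in `[0, a]) f x = f c * (b - a).
  move=> a0 ab.
  pose F x := \int[mu]_(x in `[0, x]) f x.
  (* The fundamental theorem is applied on [[0, x + 1]], of which [x] is an interior point. *)
  have dF (x : R) : 0 < x -> is_derive x 1 F (f x).
    move=> x0; have xx : x < x + 1 by rewrite ltrDl.
    have [d1 d2] : derivable F x 1 /\ derive1 F x = f x.
      apply: (continuous_FTC1_closed xx) => //; last exact: cf.
      exact: continuous_itv_integrable.
    by apply: DeriveDef; [exact: d1|rewrite -derive1E; exact: d2].
  have dab (x : R) : x \in `]a, b[ -> is_derive x 1 F (f x).
    by rewrite in_itv => /andP[ax _]; apply: dF; exact: lt_trans ax.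
  have [|c cab e] := MVT_segment ab dab; last by exists c.
  apply: derivable_within_continuous => x; rewrite in_itv => /andP[ax _].
  by case: (dF x (lt_le_trans a0 ax)).
move=> s0 t0; have [st|ts] := leP s t.
  have [c + ->] := mv s t s0 st; rewrite in_itv /= => /andP[sc ct].
  by exists c => //; rewrite !ger0_norm ?subr_ge0// lerB.
have [c + e] := mv t s t0 (ltW ts); rewrite in_itv /= => /andP[tc cs].
exists c; last by rewrite -opprB e -mulrN opprB.
by rewrite ![`|_ - s|]distrC !ger0_norm ?subr_ge0 ?(ltW ts)// lerB.
Qed.

(** A sign inside [(0, T)] suffices, as the difference of the integrals lives on []s, t]], which
    avoids 0 and [T]. *)
Lemma primitive_mono f s t T : continuous f ->
  (forall a, 0 < a < T -> 0 <= f a) -> 0 <= s -> s <= t -> t < T ->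
  \int[mu]_(a in `[0, s]) f a <= \int[mu]_(a in `[0, t]) f a.
Proof.
move=> cf f0 s0 st tT; rewrite -subr_ge0 Rintegral_itvB ?bnd_simp//; last first.
  exact: continuous_itv_integrable.
apply: Rintegral_ge0 => a; rewrite /= in_itv => /andP[sa at_].
by apply: f0; rewrite (le_lt_trans s0 sa) (le_lt_trans at_).
Qed.

(** Tube argument: joint continuity gives a neighbourhood of each [(t, p0)], and compactness of the
    segment makes the neighbourhood of [p0] independent of [t]. *)
Lemma near_unif_segment (V : topologicalType) (F : R -> V -> R) a b p0 e :
  continuous (fun z : R * V => F z.1 z.2) -> 0 < e ->
  \forall p \near p0, forall t, a <= t <= b -> `|F t p - F t p0| < e.
Proof.
move=> cF e0.
have /compact_near_coveringP cov := @segment_compact R a b.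
suff : \forall p \near p0, `[a, b] `<=` (fun t => `|F t p - F t p0| < e).
  by apply: filterS => p h t tab; apply: h; rewrite /= in_itv.
apply: (cov _ _ (fun p t => `|F t p - F t p0| < e)).
  move=> t _.
  have h1 : (fun z : R * V => F z.1 z.2 - F z.1 p0) @ (t, p0) --> (0 : R).
    rewrite -(subrr (F t p0)); apply: cvgB; first exact: (cF (t, p0)).
    have h2 : ((fun z : R * V => (z.1, p0)) @ (t, p0)) --> (t, p0).
      exact: cvg_pair cvg_fst (cvg_cst p0).
    exact: (cvg_comp _ (fun z : R * V => F z.1 z.2) h2 (cF (t, p0))).
  by move/cvgr0Pnorm_lt : h1 => /(_ _ e0).
Qed.

End ContinuousIntegrand.

(** * Continuity and differentiation of integrals depending on a parameter *)

Section Primitive.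
Context {R : realType}.
Notation mu := (@lebesgue_measure R).

Lemma continuous_slice (U V W : topologicalType) (F : U -> V -> W) (p : V) :
  continuous (fun z : U * V => F z.1 z.2) -> continuous (F ^~ p).
Proof.
move=> cF t.
exact: (cvg_comp _ (fun z : U * V => F z.1 z.2)
  (cvg_pair cvg_id (cvg_cst p)) (cF (t, p))).
Qed.

Lemma primitive_continuous_param (V : topologicalType) (F : R -> V -> R) a b :
  continuous (fun z : R * V => F z.1 z.2) ->
  continuous (fun p => \int[mu]_(x in `[a, b]) F x p).
Proof.
move=> cF p0; have cp p : continuous (F ^~ p).
  exact: (@continuous_slice _ _ _ F).
(* In what follows [M] bounds the length of the segment; the added 1 keeps it positive when
   [a = b]. *)
have ip p : mu.-integrable `[a, b] (EFin \o F ^~ p).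
  exact: continuous_itv_integrable.
apply/cvgrPdist_le => e e0; pose M := `|b - a| + 1.
have M0 : 0 < M by rewrite ltr_wpDl.
have eM : 0 < e / M by rewrite divr_gt0.
move: (near_unif_segment a b p0 cF eM); apply: filterS => p hp.
rewrite distrC -RintegralB//.
apply: (le_trans (le_normr_Rintegral _ _)) => //.
  by apply: continuous_itv_integrable => x; apply: cvgB; exact: cp.
have le1 : \int[mu]_(x in `[a, b]) `|F x p - F x p0| <=
    \int[mu]_(x in `[a, b]) (e / M).
  apply: le_Rintegral => //.
  - apply: continuous_itv_integrable => x.
    by apply: cvg_norm; apply: cvgB; exact: cp.
  - by apply: continuous_itv_integrable => x; exact: cvg_cst.
  - by move=> x; rewrite /= in_itv => xab; exact/ltW/hp.
apply: (le_trans le1); rewrite Rintegral_cst//= lebesgue_measure_itv /=.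
rewrite lte_fin; case: ifPn => [ab|_]; last by rewrite mulr0 ltW.
rewrite -EFinD /= mulrAC ler_pdivrMr// ler_pM2l// /M.
by rewrite (le_trans (ler_norm _))// lerDl.
Qed.

(** Split [J s q - J t p] at [J t q]: the change of end time is controlled by the mean value theorem
    and a local bound on [F], the change of parameter by the preceding lemma. *)
Lemma primitive_continuous (V : topologicalType) (F : R -> V -> R) t p :
  continuous (fun z : R * V => F z.1 z.2) -> 0 < t ->
  {for (t, p), continuous (fun z : R * V => \int[mu]_(x in `[0, z.1]) F x z.2)}.
Proof.
move=> cF t0; have cp q : continuous (F ^~ q).
  exact: (@continuous_slice _ _ _ F).
pose J s q := \int[mu]_(x in `[0, s]) F x q.
have bnd : \forall z \near (t, p),
    `|J z.1 z.2 - J t z.2| <= (`|F t p| + 1) * `|z.1 - t|.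
  have : \forall z \near (t, p), `|F z.1 z.2| < `|F t p| + 1.
    have := cF (t, p) => /cvg_norm h.
    by apply: (cvgr_lt _ h); rewrite ltrDl.
  move=> -[[A B] /= [/nbhs_ballP[d /= d0 Ad] Bp] AB].
  (* The radius is also at most [t], so that the nearby times are positive, as [integral_mean_value]
     requires. *)
  exists (ball t (Num.min d t), B) => /=.
    split=> //; apply/nbhs_ballP; exists (Num.min d t) => //=.
    by rewrite lt_min d0.
  move=> -[s q] [/= sb Bq].
  have [sd st] : `|t - s| < d /\ `|t - s| < t.
    by move: sb; rewrite -ball_normE /= lt_min => /andP.
  have s0 : 0 < s by move: st; rewrite ltr_norml => /andP[_]; lra.
  have [c ct ->] := integral_mean_value (cp q) t0 s0.
  rewrite normrM ler_wpM2r//; apply/ltW/(AB (c, q)); split => //=.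
  by apply: Ad; rewrite -ball_normE /= distrC (le_lt_trans ct)// distrC.
apply: (@cvg_sub0 _ _ _ _ _ _ (fun z => J t z.2)).
  apply: norm_cvg0.
  apply: (@squeeze_cvgr _ _ _ _ (cst 0) (fun z => (`|F t p| + 1) * `|z.1 - t|)).
  - by move: bnd; apply: filterS => z ->; rewrite normr_ge0.
  - exact: cvg_cst.
  - rewrite -[X in _ --> X](mulr0 (`|F t p| + 1)).
    apply: cvgMl_tmp; rewrite -(@normr0 _ R) -(subrr t).
    by apply: cvg_norm; apply: cvgB; [exact: cvg_fst|exact: cvg_cst].
apply: (cvg_comp _ (J t) cvg_snd).
exact: primitive_continuous_param.
Qed.

Context {n : nat}.
Implicit Types (F : R -> 'rV[R]_n -> R) (p q v : 'rV[R]_n).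

(** [C1_slab] states joint continuity for the derivatives only. For the function itself, a local
    bound on the gradient makes it Lipschitz in [p] uniformly in time, and continuity in time at
    fixed [p] does the rest. *)
Lemma grad_continuous_joint F :
  (forall p, continuous (F ^~ p)) -> (forall t p, differentiable (F t) p) ->
  continuous (fun z : R * 'rV[R]_n => grad (F z.1) z.2) ->
  continuous (fun z : R * 'rV[R]_n => F z.1 z.2).
Proof.
move=> cF dF cG [t p].
have bnd : \forall z \near (t, p), `|F z.1 z.2 - F z.1 p| <=
    n%:R * ((`|grad (F t) p| + 1) * `|z.2 - p|).
  have : \forall z \near (t, p), `|grad (F z.1) z.2| < `|grad (F t) p| + 1.
    have := cG (t, p) => /cvg_norm h.
    by apply: (cvgr_lt _ h); rewrite ltrDl.
  move=> -[[A B] /= [At /nbhs_ballP[d /= d0 Bd]] AB].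
  exists (A, ball p d) => /=; first by split=> //; exact: nbhsx_ballx.
  move=> -[s q] [/= As qd].
  have [c /andP[c0 c1] ->] := MVT_line p q (dF s).
  rewrite (le_trans (dotp_le _ _))// ler_wpM2l// ler_wpM2r//.
  apply/ltW/(AB (s, _)); split => //=; apply: Bd.
  move: qd; rewrite -ball_normE /= opprD addrA subrr add0r normrN normrZ => qd.
  rewrite ger0_norm// (le_lt_trans _ qd)// distrC.
  by rewrite -[leRHS]mul1r ler_wpM2r.
apply: (@cvg_sub0 _ _ _ _ _ _ (fun z => F z.1 p)).
  apply: norm_cvg0.
  apply: (@squeeze_cvgr _ _ _ _ (cst 0)
    (fun z => n%:R * ((`|grad (F t) p| + 1) * `|z.2 - p|))).
  - by move: bnd; apply: filterS => z ->; rewrite normr_ge0.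
  - exact: cvg_cst.
  - rewrite -[X in _ --> X](mulr0 n%:R).
    rewrite -[X in _ * X](mulr0 (`|grad (F t) p| + 1)).
    apply: cvgMl_tmp; apply: cvgMl_tmp.
    rewrite -(@normr0 _ 'rV[R]_n) -(subrr p).
    by apply: cvg_norm; apply: cvgB; [exact: cvg_snd|exact: cvg_cst].
apply: (cvg_comp _ (F ^~ p) cvg_fst); exact: cF.
Qed.

Lemma Rintegral_dotp (f : R -> 'rV[R]_n) v a b : continuous f ->
  \int[mu]_(x in `[a, b]) dotp (f x) v =
  dotp (\row_i \int[mu]_(x in `[a, b]) f x 0 i) v.
Proof.
move=> cf; have cfi i : continuous (fun x : R => f x 0 i).
  move=> x; exact: (cvg_comp f (fun M => M 0 i) (cf x)
    (@coord_continuous R 1 n 0 i _)).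
rewrite Rintegral_sum => [|i x]; last first.
  by apply: cvgM; [exact: cfi|exact: cvg_cst].
apply: eq_bigr => i _; rewrite RintegralZr//; first by rewrite !mxE.
exact: continuous_itv_integrable.
Qed.

Lemma primitive_derive F t q v :
  continuous (fun z : R * 'rV[R]_n => F z.1 z.2) ->
  (forall t p, differentiable (F t) p) ->
  continuous (fun z : R * 'rV[R]_n => grad (F z.1) z.2) ->
  h^-1 * (\int[mu]_(x in `[0, t]) F x (q + h *: v) -
          \int[mu]_(x in `[0, t]) F x q) @[h --> 0^'] -->
  dotp (\row_i \int[mu]_(x in `[0, t]) grad (F x) q 0 i) v.
Proof.
move=> cF dF cG; pose g x (s : R) := dotp (grad (F x) (q + s *: v)) v.
have cg : continuous (fun z : R * R => g z.1 z.2).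
  move=> [x s]; apply: dotp_cvg; last exact: cvg_cst.
  have h : ((fun z : R * R => q + z.2 *: v) @ (x, s)) --> q + s *: v.
    by apply: cvgD; [exact: cvg_cst|apply: cvgZr_tmp; exact: cvg_snd].
  exact: (cvg_comp _ (fun z : R * _ => grad (F z.1) z.2) (cvg_pair cvg_fst h)
    (cG (x, q + s *: v))).
(* For [|s| < e] the derivative [g x s] stays within 1 of [g x 0] for all [x] in the segment; this
   yields the dominating function [|g x 0| + 1]. *)
have /nbhs_ballP[e /= e0 he] := near_unif_segment 0 t (0 : R) cg ltr01.
have dl (x s : R) : is_derive s 1 (fun s => F x (q + s *: v)) (g x s).
  exact: derivable_line.
have g0 x : g x 0 = dotp (grad (F x) q) v by rewrite /g scale0r addr0.
have -> : dotp (\row_i \int[mu]_(x in `[0, t]) grad (F x) q 0 i) v =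
    \int[mu]_(x in `[0, t]) g x 0.
  under [RHS]eq_Rintegral do rewrite g0.
  rewrite Rintegral_dotp//.
  exact: (@continuous_slice _ _ _ (fun t p => grad (F t) p)).
have cFl s : continuous (fun x => F x (q + s *: v)).
  exact: (@continuous_slice _ _ _ F).
have e1 : (0 : R) \in `]- e, e[ by rewrite in_itv /= oppr_lt0 e0.
have d1E s x : partial1of2 (fun s x => F x (q + s *: v)) s x = g x s.
  by rewrite partial1of2E; case: (dl x s).
have -> : \int[mu]_(x in `[0, t]) g x 0 =
    \int[mu]_(x in `[0, t]) partial1of2 (fun s x => F x (q + s *: v)) 0 x.
  by apply: eq_Rintegral => x _; rewrite d1E.
(* Both points of the quotient are put in the form [q + s v], with [s = h + 0] and [s = 0], to match
   differentiation under the integral at 0. *)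
under eq_cvg do rewrite -[h in (q + h *: _)]addr0.
have -> : (fun x => F x q) = (fun x => F x (q + 0 *: v)).
  by apply/funext => x; rewrite scale0r addr0.
apply: (@cvg_differentiation_under_integral R _ _ mu
  (fun s x => F x (q + s *: v)) `[0, t] (measurable_itv _) 0 (- e) e e1 _ _
  (fun x => `|g x 0| + 1)) => //.
- by move=> s _; exact: continuous_itv_integrable.
- apply: continuous_itv_integrable => x; apply: cvgD; last exact: cvg_cst.
  by apply: cvg_norm; exact: (@continuous_slice _ _ _ g 0 cg x).
- move=> s x; rewrite /= !in_itv /= => es x0t; rewrite d1E.
  have : `|g x s - g x 0| < 1.
    by apply: he => //; rewrite -ball_normE /= sub0r normrN ltr_norml.
  have := ler_normD (g x s - g x 0) (g x 0); rewrite subrK; lra.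
Qed.

End Primitive.

(** * The Fenchel conjugate and the equality case of the Fenchel-Young inequality *)

Section Fenchel.
Context {R : realType} {n : nat}.
Variable sigma : 'rV[R]_n -> R.
Implicit Types p q x y : 'rV[R]_n.

Lemma fenchel_ge x p : ((dotp x p - sigma x)%:E <= fenchel sigma p)%E.
Proof. by apply: ereal_sup_ubound; exists x. Qed.

Lemma fenchel_le p s :
  (forall x, dotp x p - sigma x <= s) -> (fenchel sigma p <= s%:E)%E.
Proof. by move=> h; apply: ge_ereal_sup => _ [x _ <-]; rewrite lee_fin. Qed.

(** The witness [x] gives an affine minorant of the conjugate that is valid everywhere; this stands
    in for lower semicontinuity. *)
Lemma fenchel_ltP p s : (s%:E < fenchel sigma p)%E ->
  exists x, s < dotp x p - sigma x.
Proof.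
by move=> /ereal_sup_gt[_ [x _ <-]]; rewrite lte_fin => h; exists x.
Qed.

Lemma fenchel_ge_fin x p s :
  fenchel sigma p = s%:E -> dotp x p - sigma x <= s.
Proof. by move=> fp; rewrite -lee_fin -fp fenchel_ge. Qed.

Lemma fenchel_grad y : convex_function setT sigma -> differentiable sigma y ->
  fenchel sigma (grad sigma y) = (dotp y (grad sigma y) - sigma y)%:E.
Proof.
move=> cs ds; apply/eqP; rewrite eq_le fenchel_ge andbT.
apply: fenchel_le => x; have := convex_grad_le x cs ds.
by rewrite dotpBr (dotpC x) (dotpC y); lra.
Qed.

(** Equality in Fenchel-Young makes [q] a subgradient of [sigma] at [y]. *)
Lemma fenchel_eq_grad y q : differentiable sigma y ->
  fenchel sigma q = (dotp y q - sigma y)%:E -> q = grad sigma y.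
Proof.
move=> ds fq; apply: grad_unique => // x.
by have := fenchel_ge_fin x fq; rewrite dotpBr !(dotpC q); lra.
Qed.

Lemma fenchel_segment p q s s' h :
  fenchel sigma p = s%:E -> fenchel sigma q = s'%:E -> 0 < h < 1 ->
  exists2 r, fenchel sigma (q + h *: (p - q)) = r%:E & r <= s' + h * (s - s').
Proof.
move=> fp fq /andP[h0 h1].
have le1 : (fenchel sigma (q + h *: (p - q)) <= (s' + h * (s - s'))%:E)%E.
  apply: fenchel_le => x; rewrite dotpDr dotpZr dotpBr.
  have := fenchel_ge_fin x fp; have := fenchel_ge_fin x fq; nra.
(* The minorant at [x = 0] excludes the value [-oo]; the upper bound excludes [+oo]. *)
have := fenchel_ge 0 (q + h *: (p - q)).
case: (fenchel _ _) le1 => //= r; rewrite lee_fin => rle _.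
by exists r.
Qed.

End Fenchel.

(** * Maximizers of the Hopf formula: stationarity and uniqueness *)

Section HopfMaximizers.
Context {R : realType} {n : nat}.
Notation mu := (@lebesgue_measure R).
Variables (sigma : 'rV[R]_n -> R) (H : R -> 'rV[R]_n -> R).
Implicit Types p q x y : 'rV[R]_n.

Let J t p := \int[mu]_(tau in `[0, t]) H tau p.

(** Maximality of [q] in real terms: [s] is the conjugate at [q], and the competitors left out have
    an infinite conjugate, hence Hopf value [-oo]. *)
Definition hopf_opt t x q s := fenchel sigma q = s%:E /\
  forall p r, fenchel sigma p = r%:E ->
    dotp x p - r - J t p <= dotp x q - s - J t q.

Lemma is_max_hopf_opt t x m : is_max (range (hopf H sigma t x)) m%:E ->
  exists qs : 'rV[R]_n * R,
    hopf_opt t x qs.1 qs.2 /\ m = dotp x qs.1 - qs.2 - J t qs.1.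
Proof.
move=> [[q _ qm] ub]; have : exists s, fenchel sigma q = s%:E.
  have := fenchel_ge sigma 0 q; move: qm; rewrite /hopf.
  by case: (fenchel _ _) => //= s _ _; exists s.
move=> [s fq]; have mE : m = dotp x q - s - J t q.
  by move: qm; rewrite /hopf fq => -[<-].
exists (q, s); split => //; split => // p r fp; rewrite -mE -lee_fin.
have : range (hopf H sigma t x) (hopf H sigma t x p) by exists p.
by move/ub; rewrite /hopf fp.
Qed.

Hypothesis sigma_convex : convex_function setT sigma.
Hypothesis dsigma : forall x, differentiable sigma x.
Hypothesis cH : continuous (fun z : R * 'rV[R]_n => H z.1 z.2).
Hypothesis dH : forall t p, differentiable (H t) p.
Hypothesis cG : continuous (fun z : R * 'rV[R]_n => grad (H z.1) z.2).

Definition grad_int t q : 'rV[R]_n :=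
  \row_i \int[mu]_(tau in `[0, t]) grad (H tau) q 0 i.

(* First-order condition: y is a subgradient at q of the Fenchel conjugate, so
   the Fenchel-Young inequality is an equality at (y, q). *)
Lemma hopf_opt_stationary t x q s : hopf_opt t x q s ->
  let y := x - grad_int t q in
  q = grad sigma y /\ s = dotp y q - sigma y.
Proof.
move=> [fq qmax] y; set p := grad sigma y; set r := dotp y p - sigma y.
have fp : fenchel sigma p = r%:E by exact: fenchel_grad.
(* Compare [q] with [q + h (p - q)] and let [h] tend to 0 from the right. As [p] attains
   Fenchel-Young at [y], the inequality amounts to [s <= <y, q> - sigma y]. *)
have : dotp x (p - q) - (r - s) <= dotp (grad_int t q) (p - q).
  apply: (cvg_dnbhs_ge
    (primitive_derive (t := t) (q := q) (v := p - q) cH dH cG)).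
  move=> h h01; have [w fw wr] := fenchel_segment fp fq h01.
  have := qmax _ _ fw; rewrite -/(J _ _) dotpDr dotpZr.
  case/andP: h01 => h0 _; rewrite ler_pdivlMl//.
  rewrite -/(J t q) -/(J t (q + h *: (p - q))); lra.
have := fenchel_ge_fin y fq.
have -> : dotp x (p - q) = dotp y (p - q) + dotp (grad_int t q) (p - q).
  by rewrite -dotpDl subrK.
rewrite dotpBr /r => le1 le2.
have sE : s = dotp y q - sigma y by lra.
by split=> //; apply: fenchel_eq_grad => //; rewrite fq sE.
Qed.

Lemma charactE t y : charact H sigma t y = y + grad_int t (grad sigma y).
Proof. by []. Qed.

(** First-order Taylor remainder of [H tau] at [q]; (A2) enters the argument only through its
    sign. *)
Definition bregman tau q p := H tau p - H tau q - dotp (grad (H tau) q) (p - q).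

Lemma continuous_bregman q p : continuous (fun tau => bregman tau q p).
Proof.
move=> tau; apply: cvgB.
  by apply: cvgB; exact: (@continuous_slice _ _ _ H).
apply: dotp_cvg; last exact: cvg_cst.
exact: (@continuous_slice _ _ _ (fun t p => grad (H t) p)).
Qed.

Lemma int_bregman t q p : \int[mu]_(tau in `[0, t]) bregman tau q p =
  J t p - J t q - dotp (grad_int t q) (p - q).
Proof.
have cHp p' : continuous (H ^~ p') by exact: (@continuous_slice _ _ _ H).
have cGq : continuous (fun x : R => grad (H x) q).
  exact: (@continuous_slice _ _ _ (fun t p => grad (H t) p)).
rewrite RintegralB//; last 2 first.
- by apply: continuous_itv_integrable => x; apply: cvgB; exact: cHp.
- apply: continuous_itv_integrable => x; apply: dotp_cvg; last exact: cvg_cst.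
  exact: cGq.
rewrite RintegralB//; [|exact: continuous_itv_integrable..].
by congr (_ - _); exact: Rintegral_dotp.
Qed.

Variable T : R.
Hypothesis bregman_sign : forall q p,
  (forall tau, 0 < tau < T -> 0 <= bregman tau q p) \/
  (forall tau, 0 < tau < T -> bregman tau q p <= 0).
Variable tstar : R.
Hypothesis tstar_lt : tstar < T.
Hypothesis x_inj : injective (charact H sigma tstar).
Hypothesis ex_opt :
  forall x, exists qs : 'rV[R]_n * R, hopf_opt tstar x qs.1 qs.2.

(** By stationarity the characteristic from [x - grad_int tstar q] reaches the same point [x] as the
    one from [y]; injectivity identifies the two origins. *)
Lemma hopf_opt_tstar y q s : hopf_opt tstar (charact H sigma tstar y) q s ->
  q = grad sigma y /\ s = dotp y q - sigma y.
Proof.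
move=> qopt; have [qE sE] := hopf_opt_stationary qopt.
suff yE : charact H sigma tstar y - grad_int tstar q = y.
  by rewrite !yE in qE sE.
by apply: x_inj; rewrite [LHS]charactE -qE subrK.
Qed.

(** A maximizer exists and must be [grad sigma y]; a competitor doing as well would be a maximizer
    too, hence the same point. *)
Lemma hopf_opt_tstar_strict y p r : let q := grad sigma y in
  fenchel sigma p = r%:E -> p != q ->
  dotp (charact H sigma tstar y) p - r - J tstar p <
  dotp (charact H sigma tstar y) q - (dotp y q - sigma y) - J tstar q.
Proof.
move=> q fp pq; have [[q' s] /= opt] := ex_opt (charact H sigma tstar y).
have [q'E sE] := hopf_opt_tstar opt; rewrite q'E -/q in sE opt.
rewrite -sE ltNge; apply/negP => le1; move/eqP: pq; apply.
have [|//] := @hopf_opt_tstar y p r; split => // p' r' fp'.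
by apply: le_trans le1; apply: opt.2.
Qed.

(** The displacement along the characteristic supplies the linear term of the Bregman remainder, so
    that time appears only in the last integral. *)
Lemma hopf_gap t y p r : let q := grad sigma y in
  (dotp (charact H sigma t y) q - (dotp y q - sigma y) - J t q) -
  (dotp (charact H sigma t y) p - r - J t p) =
  (r - dotp y p + sigma y) + \int[mu]_(tau in `[0, t]) bregman tau q p.
Proof. by move=> q; rewrite int_bregman charactE -/q !dotpDl dotpBr; ring. Qed.

Lemma hopf_opt_unique t x q s p r : 0 <= t <= tstar -> hopf_opt t x q s ->
  fenchel sigma p = r%:E -> p != q ->
  dotp x p - r - J t p < dotp x q - s - J t q.
Proof.
move=> /andP[t0 tts] /hopf_opt_stationary[]; set y := x - _ => qE sE fp pq.
have xE : x = charact H sigma t y by rewrite charactE -qE subrK.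
rewrite -subr_gt0 sE xE qE hopf_gap.
have pq' : p != grad sigma y by rewrite -qE.
(* This is the gap at time 0; it is positive because equality in Fenchel-Young would force
   [p = grad sigma y]. *)
have gap0 : 0 < r - dotp y p + sigma y.
  have := fenchel_ge_fin y fp; rewrite le_eqVlt => /predU1P[e|]; last by lra.
  by case/eqP: pq'; apply: fenchel_eq_grad => //; rewrite fp -e.
(* Nonnegative remainders: the gap at [t] is at least the one at time 0. *)
have [B0|B0] := bregman_sign (grad sigma y) p.
  apply: ltr_wpDr => //.
  rewrite (le_trans _ (primitive_mono _ B0 (lexx 0) t0 _))//.
  - by rewrite set_itv1 Rintegral_set1.
  - exact: continuous_bregman.
  - exact: le_lt_trans tstar_lt.
(* Nonpositive remainders: the gap decreases in time, hence is at least the positive one at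
   [tstar]. *)
have := hopf_opt_tstar_strict fp pq'; rewrite -subr_gt0 hopf_gap.
move/lt_le_trans; apply; rewrite lerD2l -lerN2.
have cB := @continuous_bregman (grad sigma y) p.
have NE (a : R) : - (\int[mu]_(tau in `[0, a]) bregman tau (grad sigma y) p) =
    \int[mu]_(tau in `[0, a]) (-1 * bregman tau (grad sigma y) p).
  by rewrite RintegralZl ?mulN1r//; exact: continuous_itv_integrable.
rewrite !NE; apply: (primitive_mono (T := T)) => //.
  by move=> tau; apply: cvgM; [exact: cvg_cst|exact: cB].
by move=> tau /B0; rewrite mulN1r oppr_ge0.
Qed.

End HopfMaximizers.

(** * Differentials from first-order estimates, and the linear form on time-space *)

Lemma differentiable_dist_le (R : realType) (V W : normedModType R) (f : V -> W)
    (L : {linear V -> W}) x : continuous L ->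
  (forall e, 0 < e ->
     \forall y \near x, `|f y - f x - L (y - x)| <= e * `|y - x|) ->
  differentiable f x /\ 'd f x = L :> (V -> W).
Proof.
move=> cL fL; have fE : f \o shift x = cst (f x) + L +o_ 0 id.
  apply/eqaddoP => e e0; have := fL e e0.
  rewrite [X in X -> _](near_shift 0 x) /=; apply: filterS => h.
  by rewrite /= subr0 addrK fctE /= opprD addrA.
have dE := diff_unique cL fE.
by split=> //; apply/diff_locallyP; rewrite dE.
Qed.

Section TimeSpaceForm.
Context {R : realType} {n : nat}.
Notation V := 'rV[R]_n.
Implicit Types (a : R) (p : V).

Definition time_space_form a p (h : R * V) : R := dotp h.2 p - h.1 * a.

Fact time_space_form_linear a p : linear (time_space_form a p : R * V -> R^o).
Proof.
move=> k h1 h2; rewrite /time_space_form /= dotpDl dotpZl.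
by rewrite /GRing.scale /=; ring.
Qed.

HB.instance Definition _ a p := GRing.isLinear.Build R (R * V)%type R^o _
  (time_space_form a p) (time_space_form_linear a p).

Lemma norm_fst_le (h : R * V) : `|h.1| <= `|h|.
Proof. by rewrite [leRHS]/Num.norm /= le_max lexx. Qed.

Lemma norm_snd_le (h : R * V) : `|h.2| <= `|h|.
Proof. by rewrite [leRHS]/Num.norm /= le_max lexx orbT. Qed.

Lemma time_space_form_continuous a p : continuous (time_space_form a p).
Proof.
move=> [s x]; apply: cvgB.
  have c2 : (snd : R * V -> V) @ (s, x) --> x by exact: cvg_snd.
  have cp : (fun=> p) @ (s, x) --> p by exact: cvg_cst.
  exact: dotp_cvg.
by apply: cvgM; [exact: cvg_fst|exact: cvg_cst].
Qed.

End TimeSpaceForm.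

(** * Danskin's argument for a unique, locally bounded maximizer *)

Section Danskin.
Context {R : realType} {n : nat}.
Notation mu := (@lebesgue_measure R).
Notation V := 'rV[R]_n.
Variables (sigma : V -> R) (H : R -> V -> R).
Implicit Types (p q x : V) (z w : R * V).

Let J t p := \int[mu]_(tau in `[0, t]) H tau p.

Hypothesis cH : continuous (fun z : R * V => H z.1 z.2).
Variables (A : set (R * V)) (Q : R * V -> V) (S u : R * V -> R).
Hypothesis openA : open A.
Hypothesis A_gt0 : forall z, A z -> 0 < z.1.
Hypothesis Q_opt : forall z, A z -> hopf_opt sigma H z.1 z.2 (Q z) (S z).
Hypothesis uE : forall z, A z -> u z = dotp z.2 (Q z) - S z - J z.1 (Q z).
Hypothesis Q_uniq : forall z p r, A z -> fenchel sigma p = r%:E -> p != Q z ->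
  dotp z.2 p - r - J z.1 p < dotp z.2 (Q z) - S z - J z.1 (Q z).
Hypothesis Q_bounded :
  forall z, A z -> exists N, \forall w \near z, `|Q w| <= N.

(** The conjugate may be infinite or discontinuous at [p]. It is replaced by an affine minorant
    [<y, p'> - sigma y] that is already large enough at [p]; the gap [g] so obtained is continuous
    in [(p', w)] and negative at [(p, z)]. *)
Lemma near_not_opt z p : A z -> p != Q z ->
  \forall p' \near p & w \near z, forall r, fenchel sigma p' = r%:E ->
    dotp w.2 p' - r - J w.1 p' < dotp w.2 (Q z) - S z - J w.1 (Q z).
Proof.
move=> Az pQ; pose v0 := dotp z.2 (Q z) - S z - J z.1 (Q z).
have [y ylt] : exists y, dotp z.2 p - J z.1 p - v0 < dotp y p - sigma y.
  apply: fenchel_ltP; have := fenchel_ge sigma 0 p.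
  case E : (fenchel sigma p) => [r| |]//= _; last by rewrite ltry.
  by rewrite lte_fin; have := Q_uniq Az E pQ; rewrite /v0; lra.
pose g (pw : V * (R * V)) : R :=
  (dotp pw.2.2 pw.1 - (dotp y pw.1 - sigma y) - J pw.2.1 pw.1) -
  (dotp pw.2.2 (Q z) - S z - J pw.2.1 (Q z)).
have z2 : (fun pw : V * (R * V) => pw.2.2) @ (p, z) --> z.2.
  exact: (cvg_comp _ snd cvg_snd cvg_snd).
have z1 : (fun pw : V * (R * V) => pw.2.1) @ (p, z) --> z.1.
  exact: (cvg_comp _ fst cvg_snd cvg_fst).
have cJ (f : V * (R * V) -> V) q : f @ (p, z) --> q ->
    (fun pw => J pw.2.1 (f pw)) @ (p, z) --> J z.1 q.
  move=> fq; exact: (cvg_comp _ _ (cvg_pair z1 fq)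
    (primitive_continuous (p := q) cH (A_gt0 Az))).
have cg : g @ (p, z) --> g (p, z).
  have p1 : fst @ (p, z) --> p by exact: cvg_fst.
  have Qc : (fun=> Q z) @ (p, z) --> Q z by exact: cvg_cst.
  apply: cvgB; apply: cvgB; [|exact: cJ| |exact: cJ].
    apply: cvgB; first exact: dotp_cvg.
    by apply: cvgB; [apply: dotp_cvg => //; exact: cvg_cst|exact: cvg_cst].
  by apply: cvgB; [exact: dotp_cvg|exact: cvg_cst].
have : \forall pw \near (p, z), g pw < 0.
  by apply: (cvgr_lt _ cg); rewrite /g /= -/v0; lra.
apply: filterS => -[p' w] /= + r fp'; rewrite /g /=.
by have := fenchel_ge_fin y fp'; lra.
Qed.

(* By compactness of {|q| <= N, |q - Q z| >= e}, near_not_opt excludes this set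
   as the location of the maximizers at all points close to z. *)
Lemma maximizer_continuous z : A z -> {for z, continuous Q}.
Proof.
move=> Az; have [N QN] := Q_bounded Az.
apply/cvgrPdist_lt => e e0.
pose K := [set p : V | `|p| <= N] `&` [set p | e <= `|Q z - p|].
have cK : compact K.
  apply: bounded_closed_compact.
    exists N; split; first exact: num_real.
    by move=> M NM p [/= pN _]; rewrite (le_trans pN)// ltW.
  have cQ : continuous (fun p : V => `|Q z - p|).
    move=> p; have Fp : Filter (nbhs p) by exact: nbhs_filter.
    by apply: cvg_norm; apply: cvgB; [exact: cst_continuous|exact: cvg_id].
  apply: closedI.
    apply: (@preimage_closed _ _ (fun p : V => `|p|) [set a : R | a <= N]).
      by move=> p _; exact: norm_continuous.
    exact: closed_le.
  apply: (@preimage_closed _ _ (fun p : V => `|Q z - p|) [set a : R | e <= a]).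
    by move=> p _; exact: cQ.
  exact: closed_ge.
pose P w p := forall r, fenchel sigma p = r%:E ->
  dotp w.2 p - r - J w.1 p < dotp w.2 (Q z) - S z - J w.1 (Q z).
have cov : \forall w \near z, K `<=` P w.
  move/compact_near_coveringP : cK => /(_ _ (nbhs z) P (nbhs_filter z)).
  apply => p [_ /= ep].
  have pQ : p != Q z.
    by apply: contraTneq ep => ->; rewrite subrr normr0 -ltNge.
  exact: near_not_opt.
have nA : nbhs z A by exact: open_nbhs_nbhs.
near=> w; rewrite ltNge; apply/negP => eQ.
have Aw : A w by exact: (near nA w).
have [fQ Qmax] := Q_opt Aw.
have KQ : K (Q w) by split => //=; near: w.
(* A value [Q w] in [K] would be beaten at [w] by the competitor [Q z]. *)
have := (near cov w _) (Q w) KQ _ fQ.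
by rewrite ltNge => /(_ _)/negP; apply => //; exact: Qmax (Q_opt Az).1.
Unshelve. all: by end_near. Qed.

(** The lower bound uses [Q z] as a competitor at [w], the upper one [Q w] as a competitor at [z];
    the mean value theorem converts the increments of [J]. *)
Lemma danskin_bounds z w : A z -> A w ->
  exists c1 c2 : R, [/\ `|c1 - z.1| <= `|w.1 - z.1|,
    `|c2 - z.1| <= `|w.1 - z.1|,
    dotp (w.2 - z.2) (Q z) - H c1 (Q z) * (w.1 - z.1) <= u w - u z &
    u w - u z <= dotp (w.2 - z.2) (Q w) - H c2 (Q w) * (w.1 - z.1)].
Proof.
move=> Az Aw; have cq q : continuous (H ^~ q).
  exact: (@continuous_slice _ _ _ H).
have [c1 c1z e1] := integral_mean_value (cq (Q z)) (A_gt0 Az) (A_gt0 Aw).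
have [c2 c2z e2] := integral_mean_value (cq (Q w)) (A_gt0 Az) (A_gt0 Aw).
exists c1, c2; split => //.
  have := (Q_opt Aw).2 _ _ (Q_opt Az).1.
  by rewrite -e1 !uE// /J dotpBl; lra.
have := (Q_opt Az).2 _ _ (Q_opt Aw).1.
by rewrite -e2 !uE// /J dotpBl; lra.
Qed.

Lemma danskin z : A z -> differentiable u z /\
  'd u z = time_space_form (H z.1 (Q z)) (Q z) :> (R * V -> R).
Proof.
move=> Az; apply: differentiable_dist_le.
  exact: time_space_form_continuous.
move=> e e0.
have nA : nbhs z A by exact: open_nbhs_nbhs.
have e2 : 0 < e / 2 by rewrite divr_gt0.
have [[B C] /= [/nbhs_ballP[d /= d0 Bd] Cq] BC] :
    \forall tq \near (z.1, Q z), `|H z.1 (Q z) - H tq.1 tq.2| < e / 2.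
  by have /cvgrPdist_lt /(_ _ e2) := @cH (z.1, Q z).
(* Half of [e] goes to the variation of [H], half to [<w.2 - z.2, Q w - Q z>], for which [dotp_le]
   costs a factor [n]; [n.+1] avoids dividing by 0 when [n = 0]. *)
have en : 0 < e / (2 * n.+1%:R) by rewrite divr_gt0// mulr_gt0.
have cQ := maximizer_continuous Az.
have nQ : \forall w \near z, C (Q w) by exact: cQ.
have nQe : \forall w \near z, `|Q z - Q w| < e / (2 * n.+1%:R).
  by move/cvgrPdist_lt : cQ => /(_ _ en).
have nd : \forall w \near z, `|z - w| < d.
  by apply/nbhs_ballP; exists d => // w; rewrite -ball_normE.
near=> w.
have Aw : A w by exact: (near nA w).
have [c1 [c2 [c1z c2z lo hi]]] := danskin_bounds Az Aw.
have wd : `|w.1 - z.1| < d.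
  by rewrite -[w.1 - z.1]/((w - z).1) (le_lt_trans (norm_fst_le _))// distrC;
    near: w.
have Hc c q : `|c - z.1| <= `|w.1 - z.1| -> C q ->
    `|H z.1 (Q z) - H c q| * `|w.1 - z.1| <= e / 2 * `|w - z|.
  move=> cz Cq'; apply: ler_pM => //; last exact: (norm_fst_le (w - z)).
  apply/ltW/(BC (c, q)); split => //=; apply: Bd.
  by rewrite -ball_normE /= distrC (le_lt_trans cz).
have h1 := Hc _ _ c1z (nbhs_singleton Cq).
have CQw : C (Q w) by near: w.
have h2 := Hc _ _ c2z CQw.
have h3 : `|dotp (w.2 - z.2) (Q w - Q z)| <= e / 2 * `|w - z|.
  rewrite (le_trans (dotp_le _ _))// mulrCA mulrC ler_pM//.
  - rewrite (@le_trans _ _ (n.+1%:R * (e / (2 * n.+1%:R))))//.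
      rewrite ler_pM// ?ler_nat// distrC ltW//; near: w; exact: nQe.
    by rewrite invfM [e * _]mulrA mulrCA mulfV ?mulr1// pnatr_eq0.
  - exact: (norm_snd_le (w - z)).
move: h1 h2; rewrite -!normrM.
move: h3 lo hi; rewrite dotpBr /time_space_form /=.
rewrite !ler_norml => /andP[h3 h3'] lo hi /andP[h1 h1'] /andP[h2 h2'].
apply/andP; split; nra.
Unshelve. all: by end_near. Qed.

Lemma danskin_C1 : C1_on A u.
Proof.
move=> z Az; split; first exact: (danskin Az).1.
move=> v; pose K w := time_space_form (H w.1 (Q w)) (Q w) v.
have DE w : A w -> 'D_v u w = K w.
  by move=> Aw; have [dw dwE] := danskin Aw; rewrite deriveE// dwE.
have nA : nbhs z A by exact: open_nbhs_nbhs.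
have cQ := maximizer_continuous Az.
have cK : K @ z --> K z.
  have Fz : Filter (nbhs z) by exact: nbhs_filter.
  have z1 : (fst : R * V -> R) @ z --> z.1 by case: (z) => ? ?; exact: cvg_fst.
  apply: cvgB; first by apply: dotp_cvg => //; exact: cvg_cst.
  apply: cvgM; first exact: cvg_cst.
  exact: (cvg_comp _ (fun z : R * V => H z.1 z.2) (cvg_pair z1 cQ)
    (@cH (z.1, Q z))).
apply/cvgrPdist_lt => e e0; move/cvgrPdist_lt : cK => /(_ e e0).
by apply: filterS2 nA => w Aw; rewrite !DE.
Qed.

End Danskin.

(** * Freezing time outside [[0, T]], and one-sided continuity *)

Section Clamp.
Context {R : realType}.
Variable T : R.
Hypothesis T_ge0 : 0 <= T.

Definition clamp (t : R) : R := Num.max 0 (Num.min T t).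

Lemma clamp_itv t : 0 <= clamp t <= T.
Proof. by rewrite /clamp le_max lexx/= ge_max T_ge0 ge_min lexx. Qed.

Lemma clamp_id t : 0 <= t <= T -> clamp t = t.
Proof. by move=> /andP[t0 tT]; rewrite /clamp min_r// max_r. Qed.

Lemma clamp_continuous : continuous clamp.
Proof.
move=> t; apply: (@continuous_max R R (cst 0) (cst T \min id)).
  exact: cst_continuous.
by apply: continuous_min; [exact: cst_continuous|exact: cvg_id].
Qed.

End Clamp.

(** Used with clamping maps, to turn continuity within the slab into continuity everywhere. *)
Lemma within_continuous_comp (U V W : topologicalType) (A : set V)
    (f : V -> W) (g : U -> V) :
  {within A, continuous f} -> continuous g -> (forall x, A (g x)) ->
  continuous (f \o g).
Proof.
move=> /subspace_continuousP cf cg gA x.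
have := cf _ (gA x); apply: cvg_comp => B /= AB.
have : nbhs x (g @^-1` (fun y => A y -> B y)) := cg x _ AB.
by rewrite /fmap /nbhs /=; apply: filterS => y /(_ (gA y)).
Qed.

Lemma within_difference_quotient_continuous (R : realType) (A : set R)
    (f : R -> R) (t l : R) :
  (f s - f t) / (s - t) @[s --> within A t^'] --> l ->
  f @ within A (nbhs t) --> f t.
Proof.
move=> fl.
have h : ((f s - f t) / (s - t)) * (s - t) @[s --> within A t^'] --> l * 0.
  apply: cvgM => //; rewrite -(subrr t).
  apply: cvgB; last exact: cvg_cst.
  by apply: cvg_within_filter; apply: cvg_within_filter; exact: cvg_id.
rewrite mulr0 in h.
apply/cvgrPdist_lt => e e0; move/cvgr0Pnorm_lt : h => /(_ e e0).
rewrite !near_withinE; apply: filterS => s h As.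
have [->|st] := eqVneq s t; first by rewrite subrr normr0.
by have := h st As; rewrite divfK ?subr_eq0// distrC.
Qed.

Lemma grad_affine (R : realType) (n : nat) (f : 'rV[R]_n -> R) x
    (c d : R) : differentiable f x ->
  grad (fun p => c * f p + d) x = c *: grad f x.
Proof.
move=> df; apply/rowP => i; rewrite !mxE.
have dfi : derivable f x (delta_mx 0 i) by exact: diff_derivable.
have -> : (fun p => c * f p + d) = (c *: f) + cst d by apply/funext.
rewrite deriveD; [|exact: derivableZ|exact: derivable_cst].
by rewrite deriveZ// derive_cst addr0.
Qed.

(** * Constant sign of the Bregman remainder under (A2) *)

Section Hamiltonian.
Context {R : realType} {n : nat}.
Variables (T : R) (H : R -> 'rV[R]_n -> R).

Lemma bregman_affine (F G : R -> 'rV[R]_n -> R) s t c d q p :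
  (forall p, F s p = c * G t p + d) -> differentiable (G t) q ->
  bregman F s q p = c * bregman G t q p.
Proof.
move=> FG dG; rewrite /bregman !FG (_ : F s = fun p => c * G t p + d).
  by rewrite grad_affine// dotpZl; ring.
exact/funext.
Qed.

Hypothesis dH : forall t p, 0 <= t <= T -> differentiable (H t) p.

Lemma condA2_bregman_sign : condA2 T H -> forall q p,
  (forall tau, 0 < tau < T -> 0 <= bregman H tau q p) \/
  (forall tau, 0 < tau < T -> bregman H tau q p <= 0).
Proof.
have itvW t : 0 < t < T -> 0 <= t <= T by move=> /andP[t0 tT]; rewrite !ltW.
move=> [[cvx|ccv]|[g [h [k [Hghk gsign]]]]] q p.
- left => t tT; have := convex_grad_le p (cvx t tT) (dH q (itvW _ tT)).
  by rewrite /bregman; lra.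
- right => t tT; have dHt := dH q (itvW _ tT).
  have := convex_grad_le p (ccv t tT) (differentiableN dHt).
  have -> : (fun p => - H t p) = (fun p => -1 * H t p + 0).
    by apply/funext => p'; rewrite mulN1r addr0.
  by rewrite grad_affine// scaleN1r dotpNl /bregman; lra.
(* In form b) [h] is not assumed differentiable, so all remainders are compared with that of [H t1]
   at one time where [g] does not vanish; the ratio [g t / g t1] is nonnegative. *)
have [[t1 /andP[t1T g1]]|g0] :=
    pselect (exists t1 : R, (0 < t1 < T) && (g t1 != 0)); last first.
  left => t tT; have gt0 : g t = 0.
    apply/eqP; apply: contra_notT g0 => gt; exists t; exact/andP.
  (* Here [H t] is constant in [p]: it is written as [0 * H t + k t]. *)
  rewrite (@bregman_affine H H t t 0 (k t)) ?mul0r//; last exact/dH/itvW.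
  by move=> p'; rewrite Hghk ?gt0 ?mul0r//; exact: itvW.
have BE t : 0 < t < T -> bregman H t q p = g t / g t1 * bregman H t1 q p.
  move=> tT; apply: (bregman_affine (d := k t - g t / g t1 * k t1)).
    by move=> p'; rewrite !Hghk; [field|exact: itvW..].
  exact/dH/itvW.
have c0 t : 0 < t < T -> 0 <= g t / g t1.
  case: gsign => gs tT; first by rewrite divr_ge0 ?gs.
  by rewrite -divrNN divr_ge0// oppr_ge0 gs.
have [B0|B0] := leP 0 (bregman H t1 q p).
  by left => t tT; rewrite BE// mulr_ge0// c0.
by right => t tT; rewrite BE// mulr_ge0_le0 ?c0 ?ltW.
Qed.

End Hamiltonian.

(** * Passing between [H] and its time-clamped version *)

Section ClampedHamiltonian.
Context {R : realType} {n : nat}.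
Variables (T : R) (H : R -> 'rV[R]_n -> R) (sigma : 'rV[R]_n -> R).
Hypothesis T_ge0 : 0 <= T.
Hypothesis H_C1 : C1_slab T H.

(* H is arbitrary outside [0, T]; with time frozen there, it becomes jointly
   continuous on the whole of R x R^n. *)
Definition clamped (t : R) := H (clamp T t).

Lemma differentiable_clamped t p : differentiable (clamped t) p.
Proof. by case: H_C1 => dH _ _; apply: dH; exact: clamp_itv. Qed.

Lemma grad_clamped_continuous :
  continuous (fun z : R * 'rV[R]_n => grad (clamped z.1) z.2).
Proof.
case: H_C1 => _ cG _.
apply: (within_continuous_comp (g := fun z => (clamp T z.1, z.2)) cG).
  move=> [t p].
  exact: (cvg_pair
    (cvg_comp _ (clamp T) cvg_fst (@clamp_continuous R T t)) cvg_snd).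
by move=> z; exact: clamp_itv.
Qed.

Lemma clamped_continuous :
  continuous (fun z : R * 'rV[R]_n => clamped z.1 z.2).
Proof.
case: H_C1 => _ _ [ft dft _].
apply: grad_continuous_joint; last exact: grad_clamped_continuous.
  move=> p; apply: (@within_continuous_comp _ _ _ `[0, T] (fun s => H s p)).
  - apply/subspace_continuousP => t; rewrite /= in_itv /= => t0T.
    exact: within_difference_quotient_continuous (dft t p t0T).
  - exact: clamp_continuous.
  - by move=> t; rewrite /= in_itv /=; exact: clamp_itv.
exact: differentiable_clamped.
Qed.

Lemma clamped_id t : 0 <= t <= T -> clamped t = H t.
Proof. by move=> t0T; rewrite /clamped clamp_id. Qed.

Lemma hopf_clamped t x q :
  t <= T -> hopf clamped sigma t x q = hopf H sigma t x q.
Proof.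
move=> tT; rewrite /hopf; congr (_ - _%:E)%E; apply: eq_Rintegral => s.
rewrite inE /= in_itv /= => /andP[s0 st].
by rewrite clamped_id// s0 (le_trans st).
Qed.

Lemma grad_int_clamped t q : t <= T -> grad_int clamped t q = grad_int H t q.
Proof.
move=> tT; apply/rowP => i; rewrite [LHS]mxE [RHS]mxE.
apply: eq_Rintegral => s; rewrite inE /= in_itv /= => /andP[s0 st].
by rewrite clamped_id// s0 (le_trans st).
Qed.

Lemma charact_clamped t y :
  t <= T -> charact clamped sigma t y = charact H sigma t y.
Proof. by move=> tT; rewrite charactE grad_int_clamped// -charactE. Qed.

Lemma bregman_clamped t q p : 0 < t < T ->
  bregman clamped t q p = bregman H t q p.
Proof. by move=> /andP[t0 tT]; rewrite /bregman clamped_id// !ltW. Qed.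

End ClampedHamiltonian.

(** * Regularity of the Hopf solution in the strip *)

Theorem theorem3p1 (R : realType) (n : nat) (T : R)
    (H : R -> 'rV[R]_n -> R) (sigma : 'rV[R]_n -> R) (u : R -> 'rV[R]_n -> R)
    (T_gt0 : 0 < T)
    (H_C1 : C1_slab T H)
    (sigma_convex : convex_function setT sigma)
    (sigma_C1 : C1_on setT sigma)
    (A1 : condA1 T H sigma)
    (A2 : condA2 T H)
    (u_hopf : forall (t : R) (x : 'rV[R]_n), 0 <= t < T ->
       is_max (range (hopf H sigma t x)) (u t x)%:E)
    (tstar : R) (tstar_itv : 0 < tstar < T)
    (x_inj : injective (charact H sigma tstar)) :
  C1_on [set z : R * 'rV[R]_n | 0 < z.1 < tstar] (fun z => u z.1 z.2).
Proof.
have [ts0 tsT] := andP tstar_itv.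
have T0 := ltW T_gt0; pose F := clamped T H.
have dsigma x : differentiable sigma x by exact: (sigma_C1 x I).1.
have F_max t x : 0 <= t < T -> is_max (range (hopf F sigma t x)) (u t x)%:E.
  move=> tT; suff -> : hopf F sigma t x = hopf H sigma t x by exact: u_hopf.
  by apply/funext => q; rewrite hopf_clamped// ltW//; case/andP: tT.
have ex_opt t x : 0 <= t < T -> exists qs : 'rV[R]_n * R,
    hopf_opt sigma F t x qs.1 qs.2 /\
    u t x = dotp x qs.1 - qs.2 -
      \int[lebesgue_measure]_(tau in `[0, t]) F tau qs.1.
  by move=> tT; exact/is_max_hopf_opt/F_max.
have /choice[qs qsP] (z : R * 'rV[R]_n) : exists qs : 'rV[R]_n * R,
    0 <= z.1 < T ->
    hopf_opt sigma F z.1 z.2 qs.1 qs.2 /\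
    u z.1 z.2 = dotp z.2 qs.1 - qs.2 -
      \int[lebesgue_measure]_(tau in `[0, z.1]) F tau qs.1.
  (* Outside [[0, T)] nothing is claimed, and [(0, 0)] is a dummy value. *)
  have [zT|] := boolP (0 <= z.1 < T); last by exists (0, 0).
  by have [qs qsP] := ex_opt z.1 z.2 zT; exists qs.
have AT (z : R * 'rV[R]_n) : 0 < z.1 < tstar -> 0 <= z.1 < T.
  by move=> /andP[z0 zts]; rewrite ltW// (lt_trans zts).
have bregman_sign q p : (forall tau, 0 < tau < T -> 0 <= bregman F tau q p) \/
    (forall tau, 0 < tau < T -> bregman F tau q p <= 0).
  case: H_C1 => dH _ _.
  case: (condA2_bregman_sign (fun t p => dH t p) A2 q p) => B0; [left|right];
    by move=> t tT; rewrite bregman_clamped// B0.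
have F_inj : injective (charact F sigma tstar).
  move=> y1 y2; have FE y := charact_clamped H sigma y (ltW tsT).
  by rewrite (FE y1) (FE y2); exact: x_inj.
have cF := clamped_continuous T0 H_C1.
have openA : open [set z : R * 'rV[R]_n | 0 < z.1 < tstar].
  have cfst : continuous (fst : R * 'rV[R]_n -> R).
    by move=> [t x]; exact: cvg_fst.
  rewrite (_ : [set _ | _] = fst @^-1` [set` `]0, tstar[]); last first.
    by apply/seteqP; split => z; rewrite /= in_itv.
  apply: open_comp; last exact: interval_open.
  by move=> z _; exact: cfst.
apply: (danskin_C1 (sigma := sigma) cF (Q := fun z => (qs z).1)
  (S := fun z => (qs z).2) openA).
- by move=> z /andP[].
- by move=> z /AT/qsP[].
- by move=> z /AT/qsP[].
- move=> z p r Az fp pQ; have [opt _] := qsP z (AT z Az).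
  apply: (hopf_opt_unique sigma_convex dsigma cF
    (differentiable_clamped T0 H_C1) (grad_clamped_continuous T0 H_C1)
    bregman_sign tsT F_inj _ _ opt fp pQ).
    move=> x; have [|qs' [qsopt _]] := ex_opt tstar x; first by rewrite ltW.
    by exists qs'.
  by case/andP: Az => /ltW -> /ltW ->.
move=> z Az; have zT := AT z Az.
have [r [N [r0 N0 A1N]]] := A1 z.1 z.2 zT; exists N.
have near_dist : \forall w \near z, `|w.1 - z.1| + enorm (w.2 - z.2) < r.
  have Fz : Filter (nbhs z) by exact: nbhs_filter.
  have z1 : (fst : R * 'rV[R]_n -> R) @ z --> z.1.
    by case: (z) => ? ?; exact: cvg_fst.
  have z2 : (snd : R * 'rV[R]_n -> 'rV[R]_n) @ z --> z.2.
    by case: (z) => ? ?; exact: cvg_snd.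
  have h : `|w.1 - z.1| + enorm (w.2 - z.2) @[w --> z] --> (0 + 0 : R).
    apply: cvgD.
      rewrite -(@normr0 _ R) -(subrr z.1); apply: cvg_norm.
      by apply: cvgB => //; exact: cvg_cst.
    apply: enorm_cvg0; rewrite -(subrr z.2).
    by apply: cvgB => //; exact: cvg_cst.
  by apply: (cvgr_lt _ h); rewrite addr0.
have nA : nbhs z [set z : R * 'rV[R]_n | 0 < z.1 < tstar].
  exact: open_nbhs_nbhs.
move: near_dist; apply: filterS2 nA => w /AT wT wr.
(* (A1) bounds the Euclidean norm, hence the sup norm: a maximizer at [w] with [enorm] above [N]
   would have a Hopf value strictly below another one, although its value is the maximum [u]. *)
rewrite (le_trans (enorm_ge _))// leNgt; apply/negP => Nq.
have [m [[q _ <-] _]] := A1N w.1 w.2 _ wT wr Nq.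
have [[fq _] uw] := qsP w wT.
have wT' : w.1 <= T by rewrite ltW//; case/andP: wT.
have -> : hopf H sigma w.1 w.2 (qs w).1 = (u w.1 w.2)%:E.
  by rewrite uw -(hopf_clamped H sigma _ _ wT') /hopf fq.
by rewrite ltNge => /negP; apply; apply: (u_hopf w.1 w.2 wT).2; exists q.
Qed.
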